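(* Let $V$ be a vertex operator algebra, and for $u\in V$ let $X(u,x)=Y(x^{L(0)}u,x)$. Then for any $n\in\mathbb{Z}$ and any $u,v\in V$ with $u$ homogeneous of conformal weight $\mathrm{wt}\,u$, $$(x_1-x_2)^nX(u,x_1)X(v,x_2)-(-x_2+x_1)^nX(v,x_2)X(u,x_1)=\sum_{j\in\mathbb{Z},\,k\geq n}\binom{\mathrm{wt}\,u-j-1}{k-n}x_1^jx_2^{n-j}X(u_kv,x_2).$$
   Context: A vertex operator algebra $V$ (over $\mathbb{C}$) is understood in the standard sense (Frenkel–Lepowsky–Meurman), with vertex operators $Y(u,x)v=\sum_{n\in\mathbb{Z}}u_nv\,x^{-n-1}$, $u_n\in\mathrm{End}\,V$, conformal vector $\omega$, $Y(\omega,x)=\sum_{n\in\mathbb{Z}} L(n)x^{-n-2}$, and $\mathbb{Z}$-grading by eigenvalues of $L(0)$ (conformal weights): $L(0)u=(\mathrm{wt}\,u)u$ for homogeneous $u$. The operator $x^{L(0)}$ acts on a homogeneous vector $u$ as multiplication by $x^{\mathrm{wt}\,u}$, extended linearly, so for homogeneous $u$, $X(u,x)=x^{\mathrm{wt}\,u}Y(u,x)$, and $X(\cdot,x)$ is linear. $x_1,x_2$ are commuting formal variables. By the usual convention, binomial expressions are expanded in nonnegative integral powers of the second variable: $(x_1-x_2)^n=\sum_{i\geq 0}\binom{n}{i}(-1)^ix_1^{n-i}x_2^i$ and $(-x_2+x_1)^n=\sum_{i\geq 0}\binom{n}{i}(-x_2)^{n-i}x_1^i$. For $r\in\mathbb{Z}$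 and $s\geq 0$, $\binom{r}{s}=\frac{r(r-1)\cdots(r-s+1)}{s!}$. The sum over $k$ is finite since $u_kv=0$ for $k$ sufficiently large. *)

(* Defs.v *)
From HB Require Import structures.
From mathcomp Require Import all_boot all_order all_algebra.
From mathcomp Require Import complex.
From mathcomp Require Import boolp classical_sets cardinality fsbigop reals.

Set Implicit Arguments.
Unset Strict Implicit.
Unset Printing Implicit Defensive.

Import Order.TTheory GRing.Theory Num.Theory.

Local Open Scope classical_set_scope.
Local Open Scope ring_scope.

(* A formal series in the variables x_1, ..., x_d, infinite in all directions,
   is a function from exponents (int, int * int, ...) to coefficients.
   An identity between (End W)-valued series is stated by applying both sides
   to an arbitrary vector w : W, so all series below are W-valued; this is also
   how infinite sums of operators are understood in formal calculus.  Infinite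
   sums are the finitely supported sums of fsbigop; in each use
   the truncation condition (u_n v = 0 for n large) makes the support finite. *)

(* Product of a scalar-valued and a vector-valued formal series. *)
Definition fmul (I : zmodType) (K : pzRingType) (W : lmodType K)
    (f : I -> K) (g : I -> W) : I -> W :=
  fun p => \sum_(q \in [set: I]) (f q *: g (p - q)).

Definition monomial (I : zmodType) (K : pzRingType) (e : I) : I -> K :=
  fun p => (p == e)%:R.

(* A series in x_2 alone, as a series in (x_1, x_2). *)
Definition in_x2 (W : zmodType) (f : int -> W) : int * int -> W :=
  fun p => if p.1 == 0 then f p.2 else 0.

Definition fderiv (K : pzRingType) (W : lmodType K) (f : int -> W) : int -> W :=
  fun m => (m + 1)%:~R *: f (m + 1).

(* r (r - 1) ... (r - s + 1) / s! *)
Definition gbinom (K : fieldType) (r : int) (s : nat) : K :=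
  (\prod_(i < s) (r - i%:Z)%:~R) / (s`!)%:R.

(* Coefficient of y^p z^q in (a y + b z)^n, expanded in nonnegative powers of
   the second variable z. *)
Definition binpow (K : fieldType) (n : int) (a b : K) (p q : int) : K :=
  if (0 <= q) && (p == n - q) then gbinom K n `|q|%N * a ^ p * b ^ q else 0.

(* Coefficient of x^a y^b z^c in x^-1 delta((y - z) / (s x)), where
   delta(t) = \sum_(m : int) t^m: the exponent m of (y - z) is - a - 1. *)
Definition fdelta (K : fieldType) (s : K) (a b c : int) : K :=
  s ^ (a + 1) * binpow (- a - 1) 1 (-1) b c.

(* Coefficient of x^m in Y(u, x) w, where Y u n is the mode u_n. *)
Definition Yseries (K : fieldType) (W : lmodType K)
    (Y : W -> int -> {linear W -> W}) (u w : W) : int -> W :=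
  fun m => Y u (- m - 1) w.

(* L(n) = omega_(n + 1), since Y(omega, x) = \sum_n L(n) x^(- n - 2). *)
Definition Lmode (K : fieldType) (W : lmodType K)
    (Y : W -> int -> {linear W -> W}) (omega : W) (n : int) : {linear W -> W} :=
  Y omega (n + 1).

(* The Jacobi identity applied to w; the exponents (a, b, c) are those of
   x_0, x_1, x_2. *)
Definition jacobi (K : fieldType) (W : lmodType K)
    (Y : W -> int -> {linear W -> W}) (u v w : W) : Prop :=
  forall p : int * int * int,
    fmul (fun '(a, b, c) => fdelta 1 a b c)
         (fun '(a, b, c) =>
            if a == 0 then Yseries Y u (Yseries Y v w c) b else 0) p
    - fmul (fun '(a, b, c) => fdelta (-1) a c b)
         (fun '(a, b, c) =>
            if a == 0 then Yseries Y v (Yseries Y u w b) c else 0) p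
    = fmul (fun '(a, b, c) => fdelta 1 c b a)
         (fun '(a, b, c) =>
            if b == 0 then Yseries Y (Yseries Y u v a) w c else 0) p.

(* The Z-grading is given by the projections wtproj n onto the weight spaces
   V_(n) = {v | wtproj n v = v}. *)
Record voa (R : realType) := VOA {
  voa_sort :> lmodType R[i];
  wtproj : int -> {linear voa_sort -> voa_sort};
  mode : voa_sort -> int -> {linear voa_sort -> voa_sort};
  vacuum : voa_sort;
  conformal : voa_sort;
  central_charge : R[i];
  wtproj_proj : forall m n v,
    wtproj m (wtproj n v) = if m == n then wtproj n v else 0;
  wtproj_finite : forall v, finite_set [set n | wtproj n v != 0];
  wtproj_sum : forall v, v = \sum_(n \in [set: int]) wtproj n v;
  wt_finite_dim : forall n, exists (d : nat) (b : 'I_d -> voa_sort),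
    forall v, wtproj n v = v -> exists c : 'I_d -> R[i], v = \sum_i c i *: b i;
  wt_bounded_below : exists N : int, forall n : int, n < N -> forall v, wtproj n v = 0;
  mode_linear : forall n w (a : R[i]) u v,
    mode (a *: u + v) n w = a *: mode u n w + mode v n w;
  mode_truncation : forall u v, exists N : int,
    forall n : int, N <= n -> mode u n v = 0;
  vacuum_weight : wtproj 0 vacuum = vacuum;
  conformal_weight : wtproj 2 conformal = conformal;
  vacuum_identity : forall w m,
    Yseries mode vacuum w m = if m == 0 then w else 0;
  creation : forall u,
    (forall m : int, m < 0 -> Yseries mode u vacuum m = 0)
    /\ Yseries mode u vacuum 0 = u;
  mode_jacobi : forall u v w, jacobi mode u v w;
  virasoro : forall m n w,
    let L := Lmode mode conformal in
    L m (L n w) - L n (L m w)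
    = (m - n)%:~R *: L (m + n) w
      + (if m + n == 0
         then ((m ^+ 3 - m)%:~R / 12%:R * central_charge) *: w else 0);
  L0_weight : forall n v,
    wtproj n v = v -> Lmode mode conformal 0 v = n%:~R *: v;
  L_derivative : forall u w m,
    Yseries mode (Lmode mode conformal (-1) u) w m = fderiv (Yseries mode u w) m
}.

Definition homogeneous (R : realType) (V : voa R) (u : V) (h : int) : Prop :=
  wtproj V h u = u.

(* Coefficient of x^n in x^{L(0)} u. *)
Definition xL0 (R : realType) (V : voa R) (u : V) : int -> V :=
  fun n => wtproj V n u.

(* Coefficient of x^m in X(u, x) w = Y(x^{L(0)} u, x) w. *)
Definition Xseries (R : realType) (V : voa R) (u w : V) : int -> V :=
  fun m => \sum_(n \in [set: int]) Yseries (@mode R V) (xL0 u n) w (m - n).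

(* Main.v *)
Require Import Defs.
From HB Require Import structures.
From mathcomp Require Import all_boot all_order all_algebra.
From mathcomp Require Import complex.
From mathcomp Require Import boolp classical_sets cardinality fsbigop reals.
From mathcomp Require Import zify.

Set Implicit Arguments.
Unset Strict Implicit.
Unset Printing Implicit Defensive.

Import Order.TTheory GRing.Theory Num.Theory.

Local Open Scope classical_set_scope.
Local Open Scope ring_scope.

(* Extracting the coefficient of x_0^(- n - 1) from the Jacobi identity gives
   the identity with Y in place of X and with
   sum_(m, k) binom(m, k - n) (-1)^(k - n) x_1^(m - k + n) x_2^(- m - 1)
              Y(u_k v, x_2)
   on the right.  For u, v homogeneous of weights h, l, multiply by
   x_1^h x_2^l: since u_k v has weight h + l - k - 1, substituting
   j = m - k + n + h turns this sum into the claimed one.  The general case is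
   linear in v.  The weight of u_k v comes from the n = 0 instance of the
   Jacobi identity with u := omega, i.e. [L(0), u_k] = (h - k - 1) u_k.
   All infinite sums are replaced by sums over i < N for N large. *)

Lemma fsum_nat (I : choiceType) (W : nmodType) (D : set I) (F : I -> W)
    (e : nat -> I) (N : nat) :
  injective e -> (forall i, D (e i)) ->
  (forall q, D q -> F q != 0 -> exists2 i, (i < N)%N & q = e i) ->
  \sum_(q \in D) F q = \sum_(i < N) F (e i).
Proof.
move=> e_inj De Fe; rewrite (fsbigE [seq e i | i <- iota 0 N]) /=.
- rewrite big_map -(big_mkord xpredT (fun i => F (e i))) /index_iota subn0.
  by apply: eq_bigl => i; apply/mem_set.
- by rewrite map_inj_uniq ?iota_uniq.
- by move=> _ /mapP[i _ ->].
- move=> q Dq; apply: contraNeq => /(Fe _ Dq)[i iN ->].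
  by apply: map_f; rewrite mem_iota.
Qed.

Lemma fmul_nat (I : zmodType) (K : pzRingType) (W : lmodType K) (f : I -> K)
    (g : I -> W) (p : I) (e : nat -> I) (N : nat) :
  injective e ->
  (forall q, f q != 0 -> g (p - q) != 0 -> exists i, q = e i) ->
  (forall i, (N <= i)%N -> g (p - e i) = 0) ->
  fmul f g p = \sum_(i < N) f (e i) *: g (p - e i).
Proof.
move=> e_inj supp g0; apply: fsum_nat => // q _ fg0.
have f0 : f q != 0 by apply: contraNneq fg0 => ->; rewrite scale0r.
have gq0 : g (p - q) != 0 by apply: contraNneq fg0 => ->; rewrite scaler0.
have [i qi] := supp _ f0 gq0; exists i => //; rewrite ltnNge.
by apply: contraNN gq0 => /g0; rewrite qi => ->.
Qed.

Lemma fmul_monomial (I : zmodType) (K : pzRingType) (W : lmodType K)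
    (e : I) (g : I -> W) (p : I) :
  fmul (monomial K e) g p = g (p - e).
Proof.
transitivity (\sum_(q \in [set e]) monomial K e q *: g (p - q)).
  apply/esym/fsbig_widen => // q [_ /eqP/negPf qe].
  by rewrite /= /monomial qe scale0r.
by rewrite fsbig_set1 /monomial eqxx scale1r.
Qed.

Section Binomials.
Variable K : fieldType.

Lemma gbinom0 (m : int) : gbinom K m 0 = 1.
Proof. by rewrite /gbinom big_ord0 divr1. Qed.

Lemma gbinom1 (m : int) : gbinom K m 1 = m%:~R.
Proof. by rewrite /gbinom big_ord1 divr1 subr0. Qed.

Lemma gbinom_nat_gt (m s : nat) : (m < s)%N -> gbinom K m s = 0.
Proof.
move=> ms; rewrite /gbinom (bigD1 (Ordinal ms)) //= subrr.
by rewrite !mul0r.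
Qed.

Lemma gbinom_neg (m : int) (s : nat) :
  gbinom K m s * (-1) ^+ s = gbinom K (s%:Z - 1 - m) s.
Proof.
rewrite /gbinom mulrAC; congr (_ / _).
rewrite (reindex_inj rev_ord_inj) /= mulrC -[in (-1) ^+ s](card_ord s).
rewrite -prodrN; apply: eq_bigr => i _; rewrite -rmorphN /=; congr (_%:~R).
by have := ltn_ord i; lia.
Qed.

Lemma binpow_nat (n : int) (a b : K) (i : nat) :
  binpow n a b (n - i%:Z) i%:Z = gbinom K n i * a ^ (n - i%:Z) * b ^+ i.
Proof. by rewrite /binpow eqxx andbT le0z_nat. Qed.

Lemma binpow_neq0 (n : int) (a b : K) (p q : int) :
  binpow n a b p q != 0 -> exists2 i : nat, p = n - i%:Z & q = i%:Z.
Proof.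
rewrite /binpow; case: ifP => [/andP[q0 /eqP ->] _|]; last by rewrite eqxx.
by exists `|q|%N; rewrite gez0_abs.
Qed.

End Binomials.

Section VertexOperatorAlgebra.
Variables (R : realType) (V : voa R).
Implicit Types (u v w : V) (n m h : int).

Local Notation K := R[i].
Local Notation Y := (Yseries (@mode R V)).

Lemma modeD u v n w : mode (u + v) n w = mode u n w + mode v n w.
Proof. by have := mode_linear n w 1 u v; rewrite !scale1r. Qed.

Lemma mode0 n w : mode (0 : V) n w = 0.
Proof. by apply: (addrI (mode 0 n w)); rewrite -modeD !addr0. Qed.

Lemma modeZ (a : K) u n w : mode (a *: u) n w = a *: mode u n w.
Proof. by have := mode_linear n w a u 0; rewrite mode0 !addr0. Qed.

Lemma fdelta1E n (q r : int) :
  fdelta (1 : K) (- n - 1) q r = binpow n 1 (-1) q r.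
Proof. by rewrite /fdelta exp1rz mul1r; congr binpow; lia. Qed.

Lemma fdeltaN1E n (i : nat) :
  fdelta (-1 : K) (- n - 1) (n - i%:Z) i%:Z = gbinom K n i * (-1) ^ (n - i%:Z).
Proof.
rewrite /fdelta (_ : - (- n - 1) - 1 = n); last by lia.
rewrite binpow_nat exp1rz mulr1 mulrCA; congr (_ * _).
rewrite -[(-1) ^+ i]/((-1) ^ (i%:Z)) -expfzDr ?oppr_eq0 ?oner_eq0//.
rewrite (_ : n - i%:Z = (- n - 1 + 1 + i) + 2 * (n - i%:Z)); last by lia.
rewrite [RHS]expfzDr ?oppr_eq0 ?oner_eq0//.
by rewrite -exprz_exp -[(-1) ^ 2]/((-1) ^+ 2) sqrrN expr1n exp1rz mulr1.
Qed.

Lemma fdelta_neq0 (s : K) (a b c : int) :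
  fdelta s a b c != 0 -> exists2 i : nat, b = - a - 1 - i%:Z & c = i%:Z.
Proof. by rewrite mulf_eq0 negb_or => /andP[_ /binpow_neq0]. Qed.

Lemma borcherds u v w n (b c : int) (N : nat) :
  (forall i : nat, (N <= i)%N -> Y v w (c - i%:Z) = 0) ->
  (forall i : nat, (N <= i)%N -> Y u w (b - i%:Z) = 0) ->
  (forall i : nat, (N <= i)%N -> mode u (n + i%:Z) v = 0) ->
  \sum_(i < N) (gbinom K n i * (-1) ^+ i) *:
      Y u (Y v w (c - i%:Z)) (b - n + i%:Z)
  - \sum_(i < N) (gbinom K n i * (-1) ^ (n - i%:Z)) *:
      Y v (Y u w (b - i%:Z)) (c - n + i%:Z)
  = \sum_(i < N) gbinom K (- b - 1) i *:
      Y (mode u (n + i%:Z) v) w (b + c + i%:Z + 1).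
Proof.
move=> vw0 uw0 uv0; have := mode_jacobi u v w (- n - 1, b, c).
rewrite (fmul_nat (e := fun i : nat => (- n - 1, n - i%:Z, i%:Z)) (N := N)).
- rewrite (fmul_nat (e := fun i : nat => (- n - 1, i%:Z, n - i%:Z)) (N := N)).
  + rewrite (fmul_nat (e := fun i : nat => (i%:Z, b, - b - i%:Z - 1)) (N := N)).
    * set A := \sum_(i < N) _; set B := \sum_(i < N) _.
      set C := \sum_(i < N) _ => ABC.
      suff [-> -> ->] : [/\ \sum_(i < N) (gbinom K n i * (-1) ^+ i) *:
          Y u (Y v w (c - i%:Z)) (b - n + i%:Z) = A,
        \sum_(i < N) (gbinom K n i * (-1) ^ (n - i%:Z)) *:
          Y v (Y u w (b - i%:Z)) (c - n + i%:Z) = B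
        & \sum_(i < N) gbinom K (- b - 1) i *:
          Y (mode u (n + i%:Z) v) w (b + c + i%:Z + 1) = C] by [].
      split; apply: eq_bigr => i _ /=; rewrite subrr eqxx.
      - rewrite fdelta1E binpow_nat exp1rz mulr1; congr (_ *: Y _ _ _); lia.
      - rewrite fdeltaN1E; congr (_ *: Y _ _ _); lia.
      - rewrite /fdelta exp1rz mul1r.
        rewrite -[X in binpow _ _ _ X _](_ : - (- b - i%:Z - 1) - 1 - i%:Z = b);
          last by lia.
        rewrite binpow_nat exp1rz mulr1 gbinom_neg /Yseries.
        by congr (gbinom _ _ _ *: mode (mode _ _ _) _ _); lia.
    * by move=> i j [].
    * move=> [[x y] z] /fdelta_neq0[i yE ->] /=.
      case: ifP => [/eqP byE _|]; last by rewrite eqxx.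
      by exists i; congr (_, _, _); lia.
    * move=> i /uv0 uv0i /=; rewrite subrr eqxx.
      rewrite [Y u v _](_ : _ = 0) ?[LHS]mode0//.
      by rewrite -uv0i /Yseries; congr (mode _ _ _); lia.
  + by move=> i j [].
  + move=> [[x y] z] /fdelta_neq0[i zE ->] /=.
    case: ifP => [/eqP nxE _|]; last by rewrite eqxx.
    by exists i; congr (_, _, _); lia.
  + by move=> i /uw0 /= ->; rewrite subrr eqxx /Yseries linear0.
- by move=> i j [].
- move=> [[x y] z] /fdelta_neq0[i yE ->] /=.
  case: ifP => [/eqP nxE _|]; last by rewrite eqxx.
  by exists i; congr (_, _, _); lia.
- by move=> i /vw0 /= ->; rewrite subrr eqxx /Yseries linear0.
Qed.

Lemma mode_trunc_nat u v n :
  exists M : nat, forall i : nat, (M <= i)%N -> mode u (n + i%:Z) v = 0.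
Proof.
have [N uv0] := mode_truncation u v.
by exists `|N - n|%N => i Mi; apply: uv0; lia.
Qed.

Lemma Y_trunc_nat u w m :
  exists M : nat, forall i : nat, (M <= i)%N -> Y u w (m - i%:Z) = 0.
Proof.
have [M uw0] := mode_trunc_nat u w (- m - 1).
by exists M => i /uw0 <-; rewrite /Yseries; congr (mode _ _ _); lia.
Qed.

Lemma borcherds_large u v w n (b c : int) :
  exists M : nat, forall N, (M <= N)%N ->
  \sum_(i < N) (gbinom K n i * (-1) ^+ i) *:
      Y u (Y v w (c - i%:Z)) (b - n + i%:Z)
  - \sum_(i < N) (gbinom K n i * (-1) ^ (n - i%:Z)) *:
      Y v (Y u w (b - i%:Z)) (c - n + i%:Z)
  = \sum_(i < N) gbinom K (- b - 1) i *:
      Y (mode u (n + i%:Z) v) w (b + c + i%:Z + 1).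
Proof.
have [M1 H1] := Y_trunc_nat v w c; have [M2 H2] := Y_trunc_nat u w b.
have [M3 H3] := mode_trunc_nat u v n; exists (M1 + M2 + M3)%N => N MN.
by apply: borcherds => i Ni; [apply: H1|apply: H2|apply: H3]; lia.
Qed.

Lemma weight_decomposition v :
  exists s : seq int, v = \sum_(n <- s) wtproj V n v.
Proof. by eexists; exact: wtproj_sum. Qed.

Lemma wtproj_homogeneous v n : homogeneous (wtproj V n v) n.
Proof. by rewrite /homogeneous wtproj_proj eqxx. Qed.

Lemma homogeneous_ind (P : V -> Prop) :
  (forall v h, homogeneous v h -> P v) ->
  (forall v v', P v -> P v' -> P (v + v')) -> forall v, P v.
Proof.
move=> Phom Padd v; have [s ->] := weight_decomposition v.
apply: big_ind => // [|n _]; last exact/Phom/wtproj_homogeneous.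
by apply: (Phom _ 0); rewrite /homogeneous linear0.
Qed.

Lemma wtprojE v h n : homogeneous v h -> wtproj V n v = if n == h then v else 0.
Proof. by move=> vh; rewrite -[in LHS]vh wtproj_proj vh. Qed.

Local Notation L0 := (Lmode (@mode R V) (conformal V) 0).

Lemma wtproj_L0 m v : wtproj V m (L0 v) = m%:~R *: wtproj V m v.
Proof.
have [s vE] := weight_decomposition v.
rewrite [in LHS]vE [in RHS]vE !linear_sum; apply: eq_bigr => n _ /=.
rewrite (L0_weight (wtproj_homogeneous v n)) linearZ /= wtproj_proj.
by case: eqP => [->|]; rewrite ?scaler0.
Qed.

Lemma L0_eigen_homogeneous v h : L0 v = h%:~R *: v -> homogeneous v h.
Proof.
move=> L0v; have wt0 m : m != h -> wtproj V m v = 0.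
  move=> mh; have /eqP := wtproj_L0 m v.
  rewrite L0v linearZ /= eq_sym -subr_eq0 -scalerBl scaler_eq0 -rmorphB /=.
  by rewrite intr_eq0 subr_eq0 (negPf mh) => /eqP.
rewrite /homogeneous [RHS]wtproj_sum -(fsbig_widen [set h] setT) ?fsbig_set1//.
by move=> m [_ /eqP/wt0].
Qed.

Lemma L0_mode u h k w : homogeneous u h ->
  L0 (mode u k w) = mode u k (L0 w) + (h - k - 1)%:~R *: mode u k w.
Proof.
move=> uh; set om := conformal V.
have [M /(_ M.+2)] := borcherds_large om u w 0 (- 2) (- k - 1).
rewrite -addn2 leq_addr addn2 => /(_ isT).
rewrite !big_ord_recl !big1 /=; first last.
- by move=> i _; rewrite (gbinom_nat_gt _ (m := 0)) ?mul0r ?scale0r.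
- by move=> i _; rewrite (gbinom_nat_gt _ (m := 0)) ?mul0r ?scale0r.
- by move=> i _; rewrite (gbinom_nat_gt _ (m := 1)) ?scale0r.
rewrite !gbinom0 !gbinom1 /bump /= !mulr0z !mul0r !scale0r !addr0.
rewrite expr0 expr0z !mulr1 !scale1r.
have -> : Y om (Y u w (- k - 1)) (- 2) = L0 (mode u k w).
  by rewrite /Yseries /Lmode; congr (mode _ _ (mode _ _ _)); lia.
have -> : Y u (Y om w (- 2)) (- k - 1) = mode u k (L0 w).
  by rewrite /Yseries /Lmode; congr (mode _ _ (mode _ _ _)); lia.
have -> : Y (mode om 0 u) w (- 2 + (- k - 1) + 1) = (- k - 1)%:~R *: mode u k w.
  rewrite (L_derivative u) /fderiv /Yseries.
  by congr (_%:~R *: mode _ _ _); lia.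
have -> : mode om (0 + (1 + 0)%N) u = h%:~R *: u by exact: L0_weight.
rewrite {1}/Yseries modeZ => /eqP; rewrite subr_eq => /eqP ->.
rewrite addrC (_ : - (_ + 1) - 1 = k); last by lia.
by rewrite -scalerDl -rmorphD /=; congr (_ + _%:~R *: _); lia.
Qed.

Lemma mode_homogeneous u v h l k : homogeneous u h -> homogeneous v l ->
  homogeneous (mode u k v) (h + l - k - 1).
Proof.
move=> uh vl; apply: L0_eigen_homogeneous.
rewrite (L0_mode _ _ uh) (L0_weight vl) linearZ /= -scalerDl -rmorphD /=.
by congr (_%:~R *: _); lia.
Qed.

Lemma Xseries_homogeneous u h w m : homogeneous u h ->
  Xseries u w m = Y u w (m - h).
Proof.
move=> uh; rewrite /Xseries -(fsbig_widen [set h] setT) //.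
  by rewrite fsbig_set1 /xL0 uh.
move=> n [_ /eqP/negPf nh] /=.
by rewrite /xL0 (wtprojE _ uh) nh /Yseries mode0.
Qed.

Lemma XseriesD u u' w m : Xseries (u + u') w m = Xseries u w m + Xseries u' w m.
Proof.
set D := [set n | wtproj V n u != 0] `|` [set n | wtproj V n u' != 0].
have XE z : (forall n, ~ D n -> wtproj V n z = 0) ->
    Xseries z w m = \sum_(n \in D) Y (xL0 z n) w (m - n).
  move=> z0; apply/esym/fsbig_widen => // n [_ /z0 zn0] /=.
  by rewrite /xL0 zn0 /Yseries mode0.
have D0 n : ~ D n -> wtproj V n u = 0 /\ wtproj V n u' = 0.
  by move=> /not_orP[/negP/negPn/eqP ? /negP/negPn/eqP].
rewrite !XE => [|n /D0[]|n /D0[]|n /D0[u0 u'0]] //; last first.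
  by rewrite linearD /= u0 u'0 addr0.
rewrite -fsbig_split /=; last first.
  by rewrite /D finite_setU; split; apply: wtproj_finite.
by apply: eq_fsbigr => n _; rewrite /xL0 linearD /Yseries modeD.
Qed.

Lemma XseriesDr u w w' m :
  Xseries u (w + w') m = Xseries u w m + Xseries u w' m.
Proof.
elim/homogeneous_ind: u => [u h uh|u u' IH IH'].
  by rewrite !(Xseries_homogeneous _ _ uh) /Yseries linearD.
by rewrite !XseriesD IH IH' addrACA.
Qed.

Lemma Xseries0r u m : Xseries u 0 m = 0.
Proof. by apply: (addrI (Xseries u 0 m)); rewrite -XseriesDr !addr0. Qed.

Lemma Xseries0l w m : Xseries 0 w m = 0.
Proof. by apply: (addrI (Xseries 0 w m)); rewrite -XseriesD !addr0. Qed.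

Lemma Xseries_trunc_nat u w m :
  exists M : nat, forall i : nat, (M <= i)%N -> Xseries u w (m - i%:Z) = 0.
Proof.
elim/homogeneous_ind: u => [u h uh|u u' [M uM] [M' uM']].
  have [M uM] := Y_trunc_nat u w (m - h); exists M => i /uM <-.
  by rewrite (Xseries_homogeneous _ _ uh); congr (Yseries _ _ _ _); lia.
exists (M + M')%N => i Mi.
by rewrite XseriesD uM ?uM' ?addr0 //; lia.
Qed.

Lemma Xseries_identity_large u v h n w (p : int * int) : homogeneous u h ->
  exists M : nat, forall N, (M <= N)%N ->
  \sum_(i < N) (gbinom K n i * (-1) ^+ i) *:
      Xseries u (Xseries v w (p.2 - i%:Z)) (p.1 - (n - i%:Z))
  - \sum_(i < N) (gbinom K n i * (-1) ^ (n - i%:Z)) *: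
      Xseries v (Xseries u w (p.1 - i%:Z)) (p.2 - (n - i%:Z))
  = \sum_(i < N) gbinom K (h - p.1 - 1) i *:
      Xseries (mode u (n + i%:Z) v) w (p.2 - (n - p.1)).
Proof.
move=> uh; elim/homogeneous_ind: v => [v l vl|v v' [M HM] [M' HM']].
  have [M HM] := borcherds_large u v w n (p.1 - h) (p.2 - l); exists M => N MN.
  rewrite (_ : h - p.1 - 1 = - (p.1 - h) - 1); last by lia.
  under eq_bigr do
    rewrite (Xseries_homogeneous _ _ uh) (Xseries_homogeneous _ _ vl).
  under [X in _ - X]eq_bigr do
    rewrite (Xseries_homogeneous _ _ vl) (Xseries_homogeneous _ _ uh).
  under [RHS]eq_bigr do
    rewrite (Xseries_homogeneous _ _ (mode_homogeneous _ uh vl)).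
  have {HM} := HM N MN.
  suff E (x y z x' y' z' : V) :
      x = x' -> y = y' -> z = z' -> x - y = z -> x' - y' = z'.
    by apply: E; apply: eq_bigr => i _;
      congr (_ *: Y _ _ _); try congr (Y _ _ _); lia.
  by move=> -> -> ->.
exists (M + M')%N => N MN.
under eq_bigr do rewrite XseriesD XseriesDr scalerDr.
under [X in _ - X]eq_bigr do rewrite XseriesD scalerDr.
under [RHS]eq_bigr do rewrite linearD XseriesD scalerDr.
rewrite !big_split /= opprD addrACA HM ?HM' //; lia.
Qed.

End VertexOperatorAlgebra.

(* p = (p.1, p.2) are the exponents of x_1 and x_2. *)
Theorem proposition4p2 (R : realType) (V : voa R) (n : int) (u v : V) (h : int)
    (hu : homogeneous u h) (w : V) (p : int * int) :
  fmul (fun q : int * int => binpow n (1 : R[i]) (-1) q.1 q.2)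
       (fun q => Xseries u (Xseries v w q.2) q.1) p
  - fmul (fun q : int * int => binpow n (-1 : R[i]) 1 q.2 q.1)
       (fun q => Xseries v (Xseries u w q.1) q.2) p
  = \sum_(jk \in [set jk : int * int | n <= jk.2])
      gbinom R[i] (h - jk.1 - 1) (absz (jk.2 - n)) *:
        fmul (monomial R[i] (jk.1, n - jk.1))
             (in_x2 (Xseries (mode u jk.2 v) w)) p.
Proof.
have [M HM] := Xseries_identity_large v n w p hu.
have [M1 H1] := Xseries_trunc_nat v w p.2.
have [M2 H2] := Xseries_trunc_nat u w p.1.
have [M3 H3] := mode_trunc_nat u v n.
pose N := (M + M1 + M2 + M3)%N.
rewrite [X in X - _](fmul_nat (e := fun i : nat => (n - i%:Z, i%:Z)) (N := N)).
- rewrite [X in _ - X](fmul_nat (e := fun i : nat => (i%:Z, n - i%:Z)) (N := N)).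
  + rewrite [RHS](fsum_nat (e := fun i : nat => (p.1, n + i%:Z)) (N := N)).
    * under eq_bigr do rewrite binpow_nat exp1rz mulr1.
      under [X in _ - X]eq_bigr do rewrite binpow_nat expr1n mulr1.
      rewrite HM; last by rewrite /N; lia.
      apply: eq_bigr => i _.
      by rewrite fmul_monomial /in_x2 /= subrr eqxx [n + _]addrC addrK.
    * by move=> i j [/addrI[]].
    * by move=> i /=; lia.
    * move=> [j k] /= nk; rewrite fmul_monomial /in_x2 /= subr_eq0.
      case: (p.1 =P j) => [<- F0|]; last by rewrite scaler0 eqxx.
      exists `|k - n|%N; last by congr pair; lia.
      rewrite ltnNge; apply: contraNN F0 => Nk.
      rewrite (_ : k = n + `|k - n|%N%:Z); last by lia.
      rewrite H3; last by move: Nk; rewrite /N; lia.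
      by rewrite Xseries0l scaler0.
  + by move=> i j [].
  + by move=> [x y] /binpow_neq0[i /= -> ->] _; exists i.
  + by move=> i Ni /=; rewrite H2 ?Xseries0r // ; move: Ni; rewrite /N; lia.
- by move=> i j [].
- by move=> [x y] /binpow_neq0[i /= -> ->] _; exists i.
- by move=> i Ni /=; rewrite H1 ?Xseries0r // ; move: Ni; rewrite /N; lia.
Qed.
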